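(* Let $N\ge 1$, $c\ge 1$, let $R(N)$ be the set of rank-based judged runs of length $N$ over relevance degrees $\mathcal{a}_0\prec\cdots\prec\mathcal{a}_c$, and let $\preceq$ be the replacement [rank-based] ordering on $R(N)$. Let $g$ be a gain function and let $RB>0$ be a constant. Then the generalized precision $gP$ and the generalized recall $gR$ are positive valuations on the lattice $(R(N),\wedge,\vee,\preceq)$. That is, for $M\in\{gP,gR\}$: $M(\hat r)+M(\hat s)=M(\hat r\vee\hat s)+M(\hat r\wedge\hat s)$ for all $\hat r,\hat s\in R(N)$, and $\hat r\preceq\hat s$, $\hat r\ne\hat s$ imply $M(\hat r)<M(\hat s)$.
   Context: Relevance degrees: $REL=\{\mathcal{a}_0,\ldots,\mathcal{a}_c\}$ is a finite totally ordered set (order $\preccurlyeq$) with $\mathcal{a}_0\prec\mathcal{a}_1\prec\cdots\prec\mathcal{a}_c$. A gain function is a strictly increasing map $g:REL\to[0,\infty)$ with $g(\mathcal{a}_0)=0$. Rank-based judged runs: $R(N)=REL^N$ is the set of all ordered lists $\hat r=(\hat r[1],\ldots,\hat r[N])$ of $N$ elements of $REL$. Replacement [rank-based] ordering: $\hat r\preceq\hat s$ if and only if $\hat r[k]\preccurlyeq\hat s[k]$ for all $k\in\{1,\ldots,N\}$. With this order $R(N)$ is a distributive lattice; $\wedge$ and $\vee$ denote its meet and join. Generalized precision: $gP(\hat r)=\frac1N\sum_{i=1}^N\frac{g(\hat r[i])}{g(\mathcal{a}_c)}$. Generalized recall: $gR(\hat r)=\frac1{RB}\sum_{i=1}^N\frac{g(\hat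 r[i])}{g(\mathcal{a}_c)}$, where $RB$ is a fixed positive constant (the recall base, i.e. the total number of relevant documents). *)

(* Defs.v *)
From mathcomp Require Import all_boot all_order all_algebra.
From mathcomp Require Import reals.

Set Implicit Arguments.
Unset Strict Implicit.
Unset Printing Implicit Defensive.

Import Order.Theory GRing.Theory Num.Theory.

Local Open Scope ring_scope.

(* The relevance degrees a_0 < ... < a_c form a finTBOrderType REL, in which
   a_0 is \bot and a_c is \top. *)

Definition gain_function d (REL : finTBOrderType d) (R : realType)
    (g : REL -> R) : Prop :=
  [/\ forall a, 0 <= g a,
      forall a b, (a < b)%O -> g a < g b
    & g \bot%O = 0].

(* The type alias tupleprod (as opposed to the bare tuple type) selects the
   componentwise order and the corresponding lattice operations. *)
Notation judged_run N REL := (N.-tupleprod REL).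

Lemma le_judged_runP d (REL : finTBOrderType d) (N : nat)
    (r s : judged_run N REL) :
  reflect (forall k : 'I_N, (tnth r k <= tnth s k)%O) (r <= s)%O.
Proof. rewrite Order.TupleProdOrder.leEtprod; exact: forallP. Qed.

Definition gP d (REL : finTBOrderType d) (R : realType) (g : REL -> R)
    (N : nat) (r : judged_run N REL) : R :=
  N%:R^-1 * \sum_(i < N) (g (tnth r i) / g \top%O).

Definition gR d (REL : finTBOrderType d) (R : realType) (g : REL -> R)
    (RB : R) (N : nat) (r : judged_run N REL) : R :=
  RB^-1 * \sum_(i < N) (g (tnth r i) / g \top%O).

Definition valuation d (L : latticeType d) (R : realType) (M : L -> R) : Prop :=
  forall x y : L, M x + M y = M (x `|` y)%O + M (x `&` y)%O.

Definition positive_valuation d (L : latticeType d) (R : realType)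
    (M : L -> R) : Prop :=
  valuation M /\ forall x y : L, (x <= y)%O -> x <> y -> M x < M y.

(* Main.v *)
Require Import Defs.
From mathcomp Require Import all_boot all_order all_algebra.
From mathcomp Require Import reals.

Import Order.Theory GRing.Theory Num.Theory.

Local Open Scope ring_scope.

(** Both measures are a positive constant times a sum over ranks of one strictly increasing function
    of the degree, so [sum_positive_valuation] treats them together. Meet and join act rank by rank
    on a chain, hence only permute the two degrees at each rank and preserve the total. Comparable
    distinct runs differ strictly at some rank and weakly elsewhere. *)

(** Needed so that the normalising gain [g \top] is nonzero. *)
Lemma lt_bot_top (d : Order.disp_t) (T : finTBOrderType d) :
  (1 < #|T|)%N -> (\bot < \top :> T)%O.
Proof.
move=> /card_gt1P[x [y [_ _ neq_xy]]]; rewrite lt_def le0x andbT.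
apply: contraNneq neq_xy => top_bot.
have eq0 z : z = \bot%O :> T by apply/eqP; rewrite -lex0 -top_bot lex1.
by rewrite (eq0 x) (eq0 y).
Qed.

Lemma sum_positive_valuation (d : Order.disp_t) (T : finTBOrderType d)
    (R : realType) (N : nat) (f : T -> R) (k : R) :
  0 < k -> {homo f : x y / (x < y)%O >-> x < y} ->
  positive_valuation
    (fun r : judged_run N T => k * \sum_(i < N) f (tnth r i)).
Proof.
move=> k_gt0 f_lt; split=> [r s | r s /le_judged_runP le_rs neq_rs].
  rewrite -!mulrDr -!big_split; congr (_ * _); apply: eq_bigr => i _ /=.
  rewrite Order.TupleProdOrder.tnth_join Order.TupleProdOrder.tnth_meet.
  (* Totality of the order on degrees: join and meet are the two entries themselves, possibly
     swapped. *)
  by case: (leP (tnth r i) (tnth s i)) => _; rewrite // addrC.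
have f_le : {homo f : x y / (x <= y)%O >-> x <= y} by apply: ltW_homo.
have [i neq_i] : exists i, tnth r i != tnth s i.
  apply/existsP; rewrite -negb_forall; apply/negP => /forallP eq_rs.
  by apply: neq_rs; apply: eq_from_tnth => i; apply/eqP.
(* Isolate the rank [i] where the runs differ: it supplies the strict inequality. *)
rewrite ltr_pM2l // (bigD1 i) //= [ltRHS](bigD1 i) //=.
apply: ltr_leD; first by rewrite f_lt // lt_neqAle neq_i le_rs.
by apply: ler_sum => j _; apply: f_le.
Qed.

Theorem proposition5 (d : Order.disp_t) (c : nat) (REL : finTBOrderType d)
    (R : realType) (N : nat) (g : REL -> R) (RB : R)
    (hc : (1 <= c)%N) (hREL : #|REL| = c.+1) (hN : (1 <= N)%N)
    (hg : gain_function g) (hRB : 0 < RB) :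
  positive_valuation (fun r : judged_run N REL => gP g r) /\
  positive_valuation (fun r : judged_run N REL => gR g RB r).
Proof.
have [_ g_lt g_bot] := hg.
(* Here [hc] enters: there are [c.+1 > 1] degrees. *)
have gtop_gt0 : 0 < g \top%O by rewrite -g_bot g_lt// lt_bot_top// hREL.
have h_lt : {homo (fun a => g a / g \top%O) : a b / (a < b)%O >-> a < b}.
  by move=> a b lt_ab; rewrite ltr_pM2r ?invr_gt0// g_lt.
split.
  by apply: (sum_positive_valuation d REL R N _ N%:R^-1 _ h_lt);
    rewrite invr_gt0 ltr0n.
by apply: (sum_positive_valuation d REL R N _ RB^-1 _ h_lt); rewrite invr_gt0.
Qed.
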